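(* Let $0 < p < 1$ and put $$\alpha = \frac{p^3 (2 + p)}{1 + 2p}, \qquad \beta = \frac{27}{4}\, \frac{p^2 (1+p)^2}{(1 + p + p^2)^3}.$$ Then $$(1 + p + p^2)\, F_2(\alpha) = \sqrt{1 + 2p}\; F_3(\beta).$$
   Context: $F(a,b;c;x) = {}_2F_1(a,b;c;x) = \sum_{n\ge 0} \frac{(a)_n (b)_n}{(c)_n\, n!} x^n$ is the Gauss hypergeometric function, where $(a)_n = a(a+1)\cdots(a+n-1)$. Abbreviations: $F_2(x) = F(\tfrac12, \tfrac12; 1; x)$ and $F_3(x) = F(\tfrac13, \tfrac23; 1; x)$. *)

(* Defs.v *)
From Stdlib Require Import Reals Factorial.
From Coquelicot Require Import Coquelicot.
Open Scope R_scope.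

Fixpoint pochhammer (a : R) (n : nat) : R :=
  match n with
  | O => 1
  | S m => pochhammer a m * (a + INR m)
  end.

(* [PSeries] is total, so the value is meaningful only where the series
   converges; c must not be a nonpositive integer. *)
Definition hyp2F1 (a b c x : R) : R :=
  PSeries
    (fun n => pochhammer a n * pochhammer b n / (pochhammer c n * INR (fact n)))
    x.

Definition F2 (x : R) : R := hyp2F1 (1 / 2) (1 / 2) 1 x.

Definition F3 (x : R) : R := hyp2F1 (1 / 3) (2 / 3) 1 x.

(* Main.v *)
(** Put [u = F2 alpha] and [v = m * F3 beta] with [m = sqrt (1+2p) / (1+p+p^2)],
    as functions of [p].  In self-adjoint form the hypergeometric equation
    with [a + b = c = 1] reads [(x (1-x) y')' = a b y].  Pulled back along
    [alpha] and [beta] it shows that [u] and [v] satisfy the same equation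
    [(P y')' = Q y], where [P = p (2+p) (1-p) (1+p) / 6] vanishes at [p = 0].
    Hence the weighted Wronskian [P (u v' - u' v)] is constant on [[0, 1)] and
    vanishes at [0], so [v / u] is constant, equal to its value [1] at [0]. *)

Require Import Defs.
From Stdlib Require Import Reals Lra Factorial.
From Coquelicot Require Import Coquelicot.
Open Scope R_scope.

(** * Convergence and positivity of the series with [a + b = c = 1] *)

Lemma PSeries_nonneg (c : nat -> R) (x : R) :
  (forall n, 0 <= c n) -> 0 <= x -> ex_pseries c x -> 0 <= PSeries c x.
Proof.
intros hc hx hex.
apply ex_pseries_R in hex.
unfold PSeries.
rewrite <- (PSeries_const_0 x).
unfold PSeries.
apply Series_le; [|exact hex].
intros n; rewrite Rmult_0_l; split; [lra|].
apply Rmult_le_pos; [apply hc|now apply pow_le].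
Qed.

Lemma CV_radius_bounded_coef (c : nat -> R) (x : R) :
  (forall n, Rabs (c n) <= 1) -> Rabs x < 1 -> Rbar_lt (Rabs x) (CV_radius c).
Proof.
intros hc hx.
apply Rbar_lt_le_trans with 1; [exact hx|].
apply (proj1 (CV_radius_bounded c)).
exists 1; intros n; rewrite pow1, Rmult_1_r; apply hc.
Qed.

Lemma pochhammer_1 (n : nat) : pochhammer 1 n = INR (fact n).
Proof.
induction n as [|n IH]; [reflexivity|].
rewrite fact_simpl, mult_INR, S_INR; simpl pochhammer; rewrite IH; ring.
Qed.

(** [pochhammer 1 n] is kept unsimplified so that [hyp2F1 a b 1] is convertible with
    [PSeries (hyp2F1_coef a b)]. *)
Definition hyp2F1_coef (a b : R) (n : nat) : R :=
  pochhammer a n * pochhammer b n / (pochhammer 1 n * INR (fact n)).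

Lemma hyp2F1_coef_S (a b : R) (n : nat) :
  hyp2F1_coef a b (S n) =
  (a + INR n) * (b + INR n) / (INR (S n) * INR (S n)) * hyp2F1_coef a b n.
Proof.
unfold hyp2F1_coef.
rewrite !pochhammer_1, fact_simpl, mult_INR; simpl pochhammer.
field; split; [apply INR_fact_neq_0|apply not_0_INR; discriminate].
Qed.

(** Successive coefficients have ratio [(a + n) (b + n) / (n + 1)^2], which lies in [(0, 1]] because
    [a] and [b] are below 1. The upper bound yields convergence on the open unit disc, the lower one
    positivity of the sum. *)
Lemma hyp2F1_coef_bounds (a b : R) (ha : 0 < a) (hb : 0 < b)
  (hab : a + b = 1) (n : nat) :
  0 < hyp2F1_coef a b n <= 1.
Proof.
induction n as [|n [IH0 IH1]].
- unfold hyp2F1_coef; simpl; lra.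
- rewrite hyp2F1_coef_S, S_INR.
  pose proof (pos_INR n) as hn.
  assert (hq : 0 < (a + INR n) * (b + INR n) / ((INR n + 1) * (INR n + 1)) <= 1).
  { split.
    - apply Rdiv_lt_0_compat; apply Rmult_lt_0_compat; lra.
    - apply <- Rle_div_l; [rewrite Rmult_1_l; apply Rmult_le_compat; lra|].
      apply Rmult_lt_0_compat; lra. }
  split; [now apply Rmult_lt_0_compat|].
  apply Rle_trans with (1 * 1); [apply Rmult_le_compat|]; lra.
Qed.

Lemma hyp2F1_coef_radius (a b : R) (ha : 0 < a) (hb : 0 < b)
  (hab : a + b = 1) (x : R) :
  Rabs x < 1 -> Rbar_lt (Rabs x) (CV_radius (hyp2F1_coef a b)).
Proof.
apply CV_radius_bounded_coef; intros n.
pose proof (hyp2F1_coef_bounds a b ha hb hab n); rewrite Rabs_pos_eq; lra.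
Qed.

Lemma hyp2F1_pos (a b : R) (ha : 0 < a) (hb : 0 < b)
  (hab : a + b = 1) (x : R) :
  0 <= x < 1 -> 0 < hyp2F1 a b 1 x.
Proof.
intros hx.
assert (hr : Rbar_lt (Rabs x) (CV_radius (hyp2F1_coef a b))).
{ apply hyp2F1_coef_radius; try assumption; rewrite Rabs_pos_eq; lra. }
assert (hex : ex_pseries (hyp2F1_coef a b) x) by now apply CV_radius_inside.
change (hyp2F1 a b 1 x) with (PSeries (hyp2F1_coef a b) x).
rewrite PSeries_decr_1 by exact hex.
pose proof (hyp2F1_coef_bounds a b ha hb hab 0) as h0.
assert (0 <= PSeries (PS_decr_1 (hyp2F1_coef a b)) x).
{ apply PSeries_nonneg; [|lra|].
  - intros n; apply Rlt_le, hyp2F1_coef_bounds; assumption.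
  - apply CV_radius_inside; now rewrite CV_radius_decr_1. }
nra.
Qed.

Lemma hyp2F1_0 (a b : R) : hyp2F1 a b 1 0 = 1.
Proof.
change (hyp2F1 a b 1 0) with (PSeries (hyp2F1_coef a b) 0).
rewrite PSeries_0; unfold hyp2F1_coef; simpl; field.
Qed.

Lemma is_derive_hyp2F1 (a b : R) (ha : 0 < a) (hb : 0 < b)
  (hab : a + b = 1) (x : R) :
  Rabs x < 1 -> is_derive (hyp2F1 a b 1) x (Derive (hyp2F1 a b 1) x).
Proof.
intros hx; apply Derive_correct.
exists (PSeries (PS_derive (hyp2F1_coef a b)) x).
apply is_derive_PSeries, hyp2F1_coef_radius; assumption.
Qed.

(** * The hypergeometric equation in self-adjoint form *)

Definition flux (f : R -> R) (x : R) : R := x * (1 - x) * Derive f x.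

(** Termwise antiderivative of [a * b * hyp2F1 a b 1] with constant term 0. *)
Definition flux_coef (a b : R) (n : nat) : R :=
  match n with O => 0 | S m => a * b * hyp2F1_coef a b m / INR (S m) end.

Lemma flux_coef_radius (a b : R) (ha : 0 < a) (hb : 0 < b)
  (hab : a + b = 1) (x : R) :
  Rabs x < 1 -> Rbar_lt (Rabs x) (CV_radius (flux_coef a b)).
Proof.
apply CV_radius_bounded_coef; intros [|n]; unfold flux_coef.
- rewrite Rabs_R0; lra.
- pose proof (hyp2F1_coef_bounds a b ha hb hab n) as hc.
  pose proof (pos_INR n) as hn; rewrite S_INR.
  assert (0 < a * b < 1) by nra.
  rewrite Rabs_pos_eq.
  + apply <- Rle_div_l; nra.
  + apply Rdiv_le_0_compat; nra.
Qed.

(** Comparing coefficients of [x^(n+1)] reduces this to the recurrence for [hyp2F1_coef] and to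
    [(a + n) (b + n) - n (n + 1) = a b], which is where [a + b = 1] enters. *)
Lemma flux_PSeries (a b : R) (ha : 0 < a) (hb : 0 < b)
  (hab : a + b = 1) (x : R) :
  Rabs x < 1 ->
  flux (hyp2F1 a b 1) x = PSeries (flux_coef a b) x.
Proof.
intros hx; unfold flux.
pose proof (hyp2F1_coef_radius a b ha hb hab x hx) as hr.
change (Derive (hyp2F1 a b 1) x) with (Derive (PSeries (hyp2F1_coef a b)) x).
rewrite Derive_PSeries by exact hr.
assert (hex : ex_pseries (PS_derive (hyp2F1_coef a b)) x).
{ apply CV_radius_inside; now rewrite CV_radius_derive. }
set (d := PS_derive (hyp2F1_coef a b)) in *.
replace (x * (1 - x) * PSeries d x)
  with (x * (PSeries d x - x * PSeries d x)) by ring.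
rewrite <- (PSeries_incr_1 d).
rewrite <- PSeries_minus; [|exact hex|now apply ex_pseries_incr_1].
rewrite <- PSeries_incr_1; unfold d.
apply PSeries_ext; intros [|n]; [reflexivity|].
transitivity (INR (S n) * hyp2F1_coef a b (S n) - INR n * hyp2F1_coef a b n).
(* At [n = 0] the shifted series contributes its default [zero], which agrees with [INR 0] times the
   coefficient. *)
- destruct n as [|n]; [|reflexivity].
  unfold PS_minus, PS_incr_1, PS_derive, PS_plus, PS_opp, plus, opp, zero; simpl.
  ring.
- rewrite hyp2F1_coef_S.
  change (flux_coef a b (S n)) with (a * b * hyp2F1_coef a b n / INR (S n)).
  replace b with (1 - a) by lra.
  rewrite S_INR; pose proof (pos_INR n).
  field; lra.
Qed.

Lemma is_derive_flux (a b : R) (ha : 0 < a) (hb : 0 < b)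
  (hab : a + b = 1) (x : R) :
  Rabs x < 1 ->
  is_derive (flux (hyp2F1 a b 1)) x (a * b * hyp2F1 a b 1 x).
Proof.
intros hx.
apply (is_derive_ext_loc (PSeries (flux_coef a b))).
- apply (locally_interval _ x (-1) 1); simpl;
    [apply Rabs_def2 in hx; lra|apply Rabs_def2 in hx; lra|].
  intros y hy1 hy2; symmetry; apply flux_PSeries; try assumption.
  apply Rabs_def1; lra.
- replace (a * b * hyp2F1 a b 1 x) with (PSeries (PS_derive (flux_coef a b)) x).
  + apply is_derive_PSeries, flux_coef_radius; assumption.
  + change (hyp2F1 a b 1 x) with (PSeries (hyp2F1_coef a b) x).
    rewrite <- PSeries_scal.
    apply PSeries_ext; intros n.
    change (INR (S n) * (a * b * hyp2F1_coef a b n / INR (S n))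
            = a * b * hyp2F1_coef a b n).
    field; apply not_0_INR; discriminate.
Qed.


(** * Functions with vanishing derivative *)

(** Mean value theorem. At 0 only differentiability is asked, since the derivative of the ratio is
    later shown to vanish by dividing by a factor that is 0 there. *)
Lemma constant_of_Derive_0 (k : R -> R) (b : R) :
  (forall x, 0 <= x < b -> ex_derive k x) ->
  (forall x, 0 < x < b -> Derive k x = 0) ->
  forall x, 0 <= x < b -> k x = k 0.
Proof.
intros hex h0 x [[hx|<-] hxb]; [|reflexivity].
destruct (MVT_cor2 k (Derive k) 0 x hx) as [c [hc hcx]].
- intros y hy; apply is_derive_Reals, Derive_correct, hex; lra.
- rewrite h0 in hc by lra; lra.
Qed.

(** With the root factored out, vanishing of the derivative becomes the root-free condition
    [k1 = - k p / (1 + 2 * p)]. *)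
Lemma is_derive_sqrt_mult (k : R -> R) (p k1 : R) :
  0 <= p -> is_derive k p k1 ->
  is_derive (fun q => sqrt (1 + 2 * q) * k q) p
    (sqrt (1 + 2 * p) * (k p / (1 + 2 * p) + k1)).
Proof.
intros hp hk.
auto_derive; [split; [lra|split; [now exists k1|exact I]]|].
rewrite (is_derive_unique (fun x : R => k x) _ _ hk).
assert (hs : 0 < sqrt (1 + 2 * p)) by (apply sqrt_lt_R0; lra).
assert (hss : 1 + 2 * p = sqrt (1 + 2 * p) * sqrt (1 + 2 * p))
  by (symmetry; apply sqrt_sqrt; lra).
revert hs hss; generalize (sqrt (1 + 2 * p)); intros s hs hss.
rewrite hss; field; lra.
Qed.

(** * The substitutions [alpha] and [beta] and the weighted Wronskian *)

Definition alpha (p : R) : R := p ^ 3 * (2 + p) / (1 + 2 * p).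

Definition beta (p : R) : R :=
  27 / 4 * (p ^ 2 * (1 + p) ^ 2 / (1 + p + p ^ 2) ^ 3).

Lemma alpha_bounds (p : R) : 0 <= p < 1 -> 0 <= alpha p < 1.
Proof.
intros hp; split.
- apply Rdiv_le_0_compat; [|lra].
  apply Rmult_le_pos; [apply pow_le|]; lra.
- assert (h : 1 - alpha p = (1 - p) * (1 + p) ^ 3 / (1 + 2 * p))
    by (unfold alpha; field; lra).
  assert (0 < (1 - p) * (1 + p) ^ 3 / (1 + 2 * p)).
  { apply Rdiv_lt_0_compat; [|lra].
    apply Rmult_lt_0_compat; [|apply pow_lt]; lra. }
  lra.
Qed.

Lemma beta_bounds (p : R) : 0 <= p < 1 -> 0 <= beta p < 1.
Proof.
intros hp.
assert (hs : 0 < 1 + p + p ^ 2) by nra.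
split.
- apply Rmult_le_pos; [lra|].
  apply Rdiv_le_0_compat; [|now apply pow_lt].
  apply Rmult_le_pos; apply pow_le; lra.
- assert (h : 1 - beta p = ((1 - p) * (2 + p) * (1 + 2 * p)) ^ 2
                           / (4 * (1 + p + p ^ 2) ^ 3))
    by (unfold beta; field; lra).
  assert (0 < ((1 - p) * (2 + p) * (1 + 2 * p)) ^ 2
              / (4 * (1 + p + p ^ 2) ^ 3)).
  { apply Rdiv_lt_0_compat.
    - apply pow_lt; repeat apply Rmult_lt_0_compat; lra.
    - apply Rmult_lt_0_compat; [lra|now apply pow_lt]. }
  lra.
Qed.

Lemma is_derive_alpha (p : R) : 0 <= p ->
  is_derive alpha p (6 * p ^ 2 * (1 + p) ^ 2 / (1 + 2 * p) ^ 2).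
Proof.
intros hp; unfold alpha; auto_derive; [lra|field; lra].
Qed.

Lemma is_derive_beta (p : R) : 0 <= p ->
  is_derive beta p
    (27 / 4 * (p * (1 + p) * (1 - p) * (2 + p) * (1 + 2 * p))
     / (1 + p + p ^ 2) ^ 4).
Proof.
intros hp; assert (hs : 0 < 1 + p + p ^ 2) by nra.
unfold beta; auto_derive.
- repeat apply Rmult_integral_contrapositive_currified; nra.
- field; nra.
Qed.

(* [sqrt (1 + 2 * p) * reduced_wronskian f E g H p] is [P (u v' - u' v)] for
   [u = f (alpha p)] and [v = m g (beta p)], once [E x = x (1-x) f' x] and
   [H x = x (1-x) g' x] are substituted: then [P u' = E (alpha p)],
   [P m (g (beta p))' = 2/3 H (beta p) / m], and the first summand is
   [P m' f (alpha p) g (beta p)]. *)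
Definition reduced_wronskian (f E g H : R -> R) (p : R) : R :=
  (- (p ^ 2 * (1 + p) ^ 2 * (1 - p) * (2 + p))
     / (2 * (1 + 2 * p) * (1 + p + p ^ 2)) * f (alpha p) * g (beta p)
   + 2 / 3 * (1 + p + p ^ 2) ^ 2 / (1 + 2 * p) * f (alpha p) * H (beta p)
   - E (alpha p) * g (beta p)) / (1 + p + p ^ 2).

(** This is constancy of [sqrt (1 + 2 * p)] times the reduced Wronskian. The two self-adjoint
    equations ([1/4 = 1/2 * 1/2], [2/9 = 1/3 * 2/3]) give the derivatives of [E] and [H]; once the
    values of [E] and [H] are expressed through [f1] and [g1], a rational identity in [p]
    remains. *)
Lemma is_derive_reduced_wronskian (f E g H : R -> R) (f1 g1 p : R) :
  0 <= p ->
  is_derive f (alpha p) f1 ->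
  is_derive E (alpha p) (1 / 4 * f (alpha p)) ->
  E (alpha p) = alpha p * (1 - alpha p) * f1 ->
  is_derive g (beta p) g1 ->
  is_derive H (beta p) (2 / 9 * g (beta p)) ->
  H (beta p) = beta p * (1 - beta p) * g1 ->
  is_derive (reduced_wronskian f E g H) p
    (- reduced_wronskian f E g H p / (1 + 2 * p)).
Proof.
intros hp hf hE Ea hg hH Hb.
pose proof (is_derive_alpha p hp) as ha.
pose proof (is_derive_beta p hp) as hb.
assert (hs : 0 < 1 + p + p ^ 2) by nra.
unfold reduced_wronskian; auto_derive.
- repeat split; try (eexists; eassumption); nra.
- rewrite (is_derive_unique (fun x : R => f x) _ _ hf),
    (is_derive_unique (fun x : R => E x) _ _ hE),
    (is_derive_unique (fun x : R => g x) _ _ hg),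
    (is_derive_unique (fun x : R => H x) _ _ hH),
    (is_derive_unique (fun x : R => alpha x) _ _ ha),
    (is_derive_unique (fun x : R => beta x) _ _ hb), Ea, Hb.
  generalize (f (alpha p)) (g (beta p)); intros u w.
  unfold alpha, beta; field; nra.
Qed.

(** * Vanishing of the Wronskian of [F2] and [F3] *)

Lemma is_derive_F2 (x : R) : 0 <= x < 1 -> is_derive F2 x (Derive F2 x).
Proof.
intros hx; apply (is_derive_hyp2F1 (1 / 2) (1 / 2)); try lra.
rewrite Rabs_pos_eq; lra.
Qed.

Lemma is_derive_F3 (x : R) : 0 <= x < 1 -> is_derive F3 x (Derive F3 x).
Proof.
intros hx; apply (is_derive_hyp2F1 (1 / 3) (2 / 3)); try lra.
rewrite Rabs_pos_eq; lra.
Qed.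

Lemma is_derive_flux_F2 (x : R) :
  0 <= x < 1 -> is_derive (flux F2) x (1 / 4 * F2 x).
Proof.
intros hx; replace (1 / 4) with (1 / 2 * (1 / 2)) by field.
apply is_derive_flux; try lra; rewrite Rabs_pos_eq; lra.
Qed.

Lemma is_derive_flux_F3 (x : R) :
  0 <= x < 1 -> is_derive (flux F3) x (2 / 9 * F3 x).
Proof.
intros hx; replace (2 / 9) with (1 / 3 * (2 / 3)) by field.
apply is_derive_flux; try lra; rewrite Rabs_pos_eq; lra.
Qed.

Lemma F2_pos (x : R) : 0 <= x < 1 -> 0 < F2 x.
Proof. apply hyp2F1_pos; lra. Qed.

Lemma reduced_wronskian_eq_0 (p : R) :
  0 <= p < 1 -> reduced_wronskian F2 (flux F2) F3 (flux F3) p = 0.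
Proof.
set (Z := reduced_wronskian F2 (flux F2) F3 (flux F3)); intros hp.
assert (hW : forall q, 0 <= q < 1 ->
  is_derive (fun q => sqrt (1 + 2 * q) * Z q) q 0).
{ intros q hq.
  pose proof (alpha_bounds q hq) as ha; pose proof (beta_bounds q hq) as hb.
  replace 0 with (sqrt (1 + 2 * q)
                  * (Z q / (1 + 2 * q) + - Z q / (1 + 2 * q))) by (field; lra).
  apply is_derive_sqrt_mult; [lra|].
  apply is_derive_reduced_wronskian with (Derive F2 (alpha q))
    (Derive F3 (beta q)); try reflexivity; try lra.
  - now apply is_derive_F2.
  - now apply is_derive_flux_F2.
  - now apply is_derive_F3.
  - now apply is_derive_flux_F3. }
assert (h : sqrt (1 + 2 * p) * Z p = sqrt (1 + 2 * 0) * Z 0).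
{ apply (constant_of_Derive_0 (fun q => sqrt (1 + 2 * q) * Z q) 1); [| |exact hp].
  - intros q hq; exists 0; now apply hW.
  - intros q hq; apply is_derive_unique, hW; lra. }
(* The first summand carries [p ^ 2], and both fluxes vanish because [alpha 0 = beta 0 = 0]. *)
assert (h0 : Z 0 = 0).
{ unfold Z, reduced_wronskian, flux, alpha, beta; simpl; field_simplify; lra. }
rewrite h0, Rmult_0_r in h.
apply Rmult_integral in h; destruct h as [h|h]; [|exact h].
pose proof (sqrt_lt_R0 (1 + 2 * p)); lra.
Qed.

(** * The ratio [v / u] and the identity *)

(** The function is [v / u] without its factor [sqrt (1 + 2 * p)]; quotient and chain rules apply
    since [F2] is positive on [[0, 1)]. *)
Lemma is_derive_ratio (p : R) : 0 <= p < 1 ->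
  is_derive (fun q => F3 (beta q) / ((1 + q + q ^ 2) * F2 (alpha q))) p
    ((27 / 4 * (p * (1 + p) * (1 - p) * (2 + p) * (1 + 2 * p))
        / (1 + p + p ^ 2) ^ 5 * Derive F3 (beta p) * F2 (alpha p)
      - 6 * p ^ 2 * (1 + p) ^ 2 / ((1 + 2 * p) ^ 2 * (1 + p + p ^ 2))
        * F3 (beta p) * Derive F2 (alpha p)
      - (1 + 2 * p) / (1 + p + p ^ 2) ^ 2 * F3 (beta p) * F2 (alpha p))
     / F2 (alpha p) ^ 2).
Proof.
intros hp.
pose proof (alpha_bounds p hp) as hA; pose proof (beta_bounds p hp) as hB.
pose proof (is_derive_alpha p (proj1 hp)) as ha.
pose proof (is_derive_beta p (proj1 hp)) as hb.
pose proof (is_derive_F2 _ hA) as hf; pose proof (is_derive_F3 _ hB) as hg.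
pose proof (F2_pos _ hA) as hpos.
assert (hs : 0 < 1 + p + p ^ 2) by nra.
auto_derive.
- repeat split; try (eexists; eassumption).
  apply Rmult_integral_contrapositive_currified; nra.
- rewrite (is_derive_unique (fun x : R => F2 x) _ _ hf),
    (is_derive_unique (fun x : R => F3 x) _ _ hg),
    (is_derive_unique (fun x : R => alpha x) _ _ ha),
    (is_derive_unique (fun x : R => beta x) _ _ hb).
  field; nra.
Qed.

Theorem theorem6 (p : R) (hp : 0 < p < 1) :
  let alpha := p ^ 3 * (2 + p) / (1 + 2 * p) in
  let beta := 27 / 4 * (p ^ 2 * (1 + p) ^ 2 / (1 + p + p ^ 2) ^ 3) in
  (1 + p + p ^ 2) * F2 alpha = sqrt (1 + 2 * p) * F3 beta.
Proof.
change ((1 + p + p ^ 2) * F2 (alpha p) = sqrt (1 + 2 * p) * F3 (beta p)).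
set (k := fun q => F3 (beta q) / ((1 + q + q ^ 2) * F2 (alpha q))).
assert (hk : sqrt (1 + 2 * p) * k p = sqrt (1 + 2 * 0) * k 0).
{ apply (constant_of_Derive_0 (fun q => sqrt (1 + 2 * q) * k q) 1); [| |lra].
  - intros q hq; eexists.
    apply is_derive_sqrt_mult; [lra|now apply is_derive_ratio].
  - intros q hq; assert (hq' : 0 <= q < 1) by lra.
    apply is_derive_unique.
    evar_last; [apply is_derive_sqrt_mult; [lra|now apply is_derive_ratio]|].
    pose proof (F2_pos _ (alpha_bounds q hq')) as hpos.
    assert (hs : 0 < 1 + q + q ^ 2) by nra.
    pose proof (reduced_wronskian_eq_0 q hq') as hZ.
    apply Rmult_eq_0_compat_l.
    (* This is [(v / u)' = W / (P u^2)] with the root cancelled, [W] being the weighted Wronskian;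
       the middle factor is [1 / P], finite because [0 < q < 1]. *)
    transitivity (reduced_wronskian F2 (flux F2) F3 (flux F3) q
      * (6 / (q * (2 + q) * (1 - q) * (1 + q))) / F2 (alpha q) ^ 2);
      [|rewrite hZ; field; nra].
    unfold k, reduced_wronskian, flux.
    revert hpos; clear hZ; generalize (F2 (alpha q)); intros u hpos.
    generalize (Derive F2 (alpha q)) (Derive F3 (beta q)) (F3 (beta q)).
    intros u1 w1 w; unfold alpha, beta; field; nra. }
(* Both series equal 1 at argument 0, which fixes the constant. *)
assert (h0 : sqrt (1 + 2 * 0) * k 0 = 1).
{ assert (ha : alpha 0 = 0) by (unfold alpha; field).
  assert (hb : beta 0 = 0) by (unfold beta; field).
  unfold k; rewrite ha, hb; unfold F2, F3; rewrite !hyp2F1_0.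
  replace (1 + 2 * 0) with 1 by ring; rewrite sqrt_1; field. }
rewrite h0 in hk; unfold k in hk.
assert (hp' : 0 <= p < 1) by lra.
pose proof (F2_pos _ (alpha_bounds p hp')) as hpos.
assert (hs : 0 < 1 + p + p ^ 2) by nra.
transitivity ((1 + p + p ^ 2) * F2 (alpha p)
  * (sqrt (1 + 2 * p) * (F3 (beta p) / ((1 + p + p ^ 2) * F2 (alpha p)))));
  [rewrite hk; ring|field; lra].
Qed.
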